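(* Let $n\ge 1$, let $f:\mathbb{R}^n\to\mathbb{R}\cup\{+\infty\}$ be a convex, closed and proper function, let $\{\alpha_i\}_{i\geq 1}$ be a sequence of positive step sizes, let $R>0$, and let $x_0\in\mathbb{R}^n$ be an initial iterate satisfying $\|x_0-x_*\|\leq R$ for some minimizer $x_*$ of $f$ over $\mathbb{R}^n$. Let $\{x_i\}_{i\geq 1}$ be the sequence generated by the proximal point algorithm with step sizes $\{\alpha_i\}_{i\ge 1}$ applied to $f$ (with respect to the Euclidean norm $\|\cdot\|$) started at $x_0$, i.e. $x_i=\operatorname{prox}_{\alpha_i f}(x_{i-1})$ for $i\ge 1$. Then for every $N\ge 1$ there exists a subgradient $g_N\in\partial f(x_N)$ such that $$\|g_N\|\leq \frac{R}{\sum_{i=1}^{N}\alpha_i}.$$ In particular, $g_N=\frac{x_{N-1}-x_N}{\alpha_N}$ is a subgradient of $f$ at $x_N$ satisfying this inequality.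
   Context: $\langle\cdot,\cdot\rangle$ is the standard dot product on $\mathbb{R}^n$ and $\|x\|=\sqrt{\langle x,x\rangle}$ is the Euclidean norm. The function $f$ is extended real valued and not necessarily differentiable; closed means lower semicontinuous (closed epigraph), proper means not identically $+\infty$. The proximal mapping of $f$ with parameter $\alpha>0$ is $\operatorname{prox}_{\alpha f}(x)=\operatorname{argmin}_{y\in\mathbb{R}^n}\{\alpha f(y)+\frac12\|y-x\|^2\}$, which is uniquely well defined for every $x\in\mathbb{R}^n$ by strong convexity. $\partial f(x)$ denotes the convex subdifferential of $f$ at $x$: the set of $g\in\mathbb{R}^n$ such that $f(y)\ge f(x)+\langle g,y-x\rangle$ for all $y\in\mathbb{R}^n$ (for $x$ with $f(x)<+\infty$). *)

(* Defs.v *)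
From HB Require Import structures.
From mathcomp Require Import all_boot all_order all_algebra.
From mathcomp Require Import all_classical all_reals all_analysis.

Set Implicit Arguments.
Unset Strict Implicit.
Unset Printing Implicit Defensive.

Import Order.TTheory GRing.Theory Num.Theory.
Import numFieldNormedType.Exports.

Local Open Scope classical_set_scope.
Local Open Scope ring_scope.

Definition dot (R : realType) (n : nat) (u v : 'rV[R]_n) : R :=
  \sum_(i < n) u 0 i * v 0 i.

(* The library norm [`|u|] on row vectors is the sup norm (which induces the
   same topology), hence a separate Euclidean norm. *)
Definition enorm (R : realType) (n : nat) (u : 'rV[R]_n) : R :=
  Num.sqrt (dot u u).

(* Meant for functions that never take the value [-oo], so that the right-hand
   side is never of the form [+oo - oo]; recall that [0 * +oo = 0]. *)
Definition convex_efun (R : realType) (n : nat) (f : 'rV[R]_n -> \bar R) : Prop :=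
  forall (x y : 'rV[R]_n) (t : R), 0 <= t -> t <= 1 ->
    (f (t *: x + (1 - t) *: y)%R <= t%:E * f x + (1 - t)%R%:E * f y)%E.

Definition argmin (R : realType) (T : Type) (F : T -> \bar R) : set T :=
  [set p | forall y, (F p <= F y)%E].

(* [get] picks an element of the set of minimizers, and an arbitrary point if
   there is none; for [f] convex, closed and proper and [0 < a] there is exactly
   one minimizer. *)
Definition prox (R : realType) (n : nat) (a : R) (f : 'rV[R]_n -> \bar R)
    (x : 'rV[R]_n) : 'rV[R]_n :=
  get (argmin (fun y => (a%:E * f y + (2^-1 * enorm (y - x) ^+ 2)%R%:E)%E)).

Definition subdifferential (R : realType) (n : nat) (f : 'rV[R]_n -> \bar R)
    (x : 'rV[R]_n) : set 'rV[R]_n :=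
  [set g | (f x < +oo)%E /\
           forall y, (f x + (dot g (y - x))%R%:E <= f y)%E].

(* Main.v *)
Require Import Defs.
From HB Require Import structures.
From mathcomp Require Import all_boot all_order all_algebra.
From mathcomp Require Import all_classical all_reals all_analysis.
From mathcomp Require Import finmap ring lra.

Import Order.TTheory GRing.Theory Num.Theory.
Import numFieldNormedType.Exports.

Local Open Scope classical_set_scope.
Local Open Scope ring_scope.

(** Write [A_k] for [alpha_1 + ... + alpha_k], [g_k] for
[(x_(k-1) - x_k) / alpha_k], so that [x_k = x_(k-1) - alpha_k g_k], and [xs]
for a minimizer of [f]. The step [x_k] minimizes
[alpha_k f(y) + |y - x_(k-1)|^2 / 2], and the first-order condition for this
problem says that [g_k] is a subgradient of [f] at [x_k]
([prox_subgradient]). The minimum is attained ([prox_argmin]): since [f] is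
bounded below by [f(xs)], every point that does at least as well as [xs] lies
in a ball around [x_(k-1)], and a lower semicontinuous function attains its
minimum on a compact set.

The rate comes from the potential
[E_k = A_k^2 |g_k|^2 / 2 + A_k (f(x_k) - f(xs)) + |x_k - xs|^2 / 2],
whose continuous counterpart
[t^2 |f'(x)|^2 / 2 + t (f(x) - f(xs)) + |x - xs|^2 / 2] decreases along the
gradient flow. It does not increase from one step to the next
([potential_decrease]), and [E_1 <= |x_0 - xs|^2 / 2]
([proximal_step_decrease]). The last two terms of [E_N] are nonnegative, hence
[A_N^2 |g_N|^2 <= |x_0 - xs|^2 <= r^2]. *)

Set Implicit Arguments.
Unset Strict Implicit.

(** * The Euclidean inner product *)

Section EuclideanSpace.
Context {R : realType} {n : nat}.
Implicit Types (u v w : 'rV[R]_n) (a t : R).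

Lemma dotC u v : dot u v = dot v u.
Proof. by apply: eq_bigr => i _; rewrite mulrC. Qed.

Lemma dotDl u v w : dot (u + v) w = dot u w + dot v w.
Proof. by rewrite -big_split; apply: eq_bigr => i _; rewrite mxE mulrDl. Qed.

Lemma dotZl a u v : dot (a *: u) v = a * dot u v.
Proof. by rewrite /dot mulr_sumr; apply: eq_bigr => i _; rewrite mxE mulrA. Qed.

Lemma dotDr u v w : dot u (v + w) = dot u v + dot u w.
Proof. by rewrite dotC dotDl !(dotC u). Qed.

Lemma dotZr a u v : dot u (a *: v) = a * dot u v.
Proof. by rewrite dotC dotZl dotC. Qed.

Lemma dotNl u v : dot (- u) v = - dot u v.
Proof. by rewrite -scaleN1r dotZl mulN1r. Qed.

Lemma dotNr u v : dot u (- v) = - dot u v.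
Proof. by rewrite dotC dotNl dotC. Qed.

Definition dotE := (dotDl, dotDr, dotNl, dotNr, dotZl, dotZr).

Lemma dot_ge0 u : 0 <= dot u u.
Proof. by apply: sumr_ge0 => i _; rewrite -expr2 sqr_ge0. Qed.

Lemma enorm_ge0 u : 0 <= enorm u.
Proof. exact: sqrtr_ge0. Qed.

Lemma sqr_enorm u : enorm u ^+ 2 = dot u u.
Proof. by rewrite sqr_sqrtr ?dot_ge0. Qed.

Lemma sqr_coord_le_dot u i : u 0 i ^+ 2 <= dot u u.
Proof.
rewrite /dot (bigD1 i) //= -expr2 lerDl.
by apply: sumr_ge0 => j _; rewrite -expr2 sqr_ge0.
Qed.

Lemma continuous_sqr_enorm_sub w :
  continuous (fun y : 'rV[R]_n => enorm (y - w) ^+ 2).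
Proof.
under eq_fun do rewrite sqr_enorm.
have coordB i : continuous (fun y : 'rV[R]_n => (y - w) 0 i).
  rewrite [F in continuous F](_ : _ = fun y : 'rV[R]_n => y 0 i - w 0 i).
    by move=> y; apply: continuousB;
      [exact: coord_continuous|exact: cst_continuous].
  by apply/funext => y; rewrite !mxE.
rewrite /dot; apply: continuous_big => [|i _ y].
  exact: add_continuous.
by apply: continuousM; exact: coordB.
Qed.

End EuclideanSpace.

(** * Minimization of lower semicontinuous functions *)

Section LowerSemicontinuity.
Context {R : realType}.

Lemma lower_semicontinuous_scale_add {X : topologicalType}
    (f : X -> \bar R) (a : R) (h : X -> R) :
  (forall y, (-oo < f y)%E) -> 0 < a ->
  lower_semicontinuous f -> continuous h ->
  lower_semicontinuous (fun y => (a%:E * f y + (h y)%:E)%E).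
Proof.
move=> f_gtNy a0 fl hc y b bf.
(* The bound [b] is shared between the two summands: [a * c] for [a * f] and
   [b - a * c] for [h]. *)
have [c cf bc] : exists2 c : R, (c%:E < f y)%E & b < a * c + h y.
  move: bf (f_gtNy y); case: (f y) => [v| |] //=.
  - rewrite -EFinM -EFinD lte_fin => bv _.
    exists (v - (a * v + h y - b) / (2 * a)).
      by rewrite lte_fin gtrBl divr_gt0 ?mulr_gt0// subr_gt0.
    rewrite mulrBr [X in _ - X](_ : _ = (a * v + h y - b) / 2).
      by lra.
    by field; rewrite gt_eqF.
  - move=> _ _; exists ((b + 1 - h y) / a); first exact: ltry.
    by rewrite mulrCA divff ?gt_eqF// mulr1; lra.
have [V yV Vf] := fl _ _ cf.
have hV : nbhs y [set z | b - a * c < h z].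
  apply: (hc y [set s | b - a * c < s]).
  by apply: lt_nbhsr; rewrite ltrBlDl.
exists (V `&` [set z | b - a * c < h z]); first exact: filterI.
move=> z [/Vf cz /= bz].
move: cz (f_gtNy z); case: (f z) => [v| |] //=.
- rewrite -EFinM -EFinD !lte_fin => cv _.
  have : a * c < a * v by rewrite ltr_pM2l.
  by lra.
- by move=> _ _; rewrite gt0_muley ?lte_fin// ltry.
Qed.

(** If no point of [K] were a minimizer, then the open sets [{z | g q < g z}]
for [q] in [K] would cover [K]. Finitely many of them would suffice, but a [q]
with least value [g q] among the finitely many indices belongs to none. *)
Lemma lower_semicontinuous_attains_min {T : ptopologicalType}
    (K : set T) (g : T -> \bar R) :
  compact K -> K !=set0 -> lower_semicontinuous g ->
  exists2 p, K p & forall q, K q -> (g p <= g q)%E.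
Proof.
move=> cK [q0 Kq0] gl; apply: contrapT => noargmin.
have lower q : K q -> exists2 q', K q' & (g q' < g q)%E.
  move=> Kq; apply: contrapT => nq'; apply: noargmin; exists q => // q' Kq'.
  by rewrite leNgt; apply/negP => q'q; apply: nq'; exists q'.
move: cK; rewrite compact_cover.
move=> /(_ T K (fun q => [set z | (g q < g z)%E])) [].
- move=> q Kq.
  (* Lower semicontinuity speaks of real levels; [lower] excludes the level
     [-oo], and the level [+oo] gives the empty set. *)
  move: (lower _ Kq) => [q' _]; case: (g q) => [v _| |].
  + by move/lower_semicontinuousP : gl; exact.
  + move=> _; rewrite [X in open X](_ : _ = set0); first exact: open0.
    by apply/seteqP; split => // z /=; rewrite ltNge leey.
  + by rewrite ltNge leNye.
- by move=> z /lower[q' Kq' q'z]; exists q'.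
move=> D DK Dcover.
have [i0 Di0 _] := Dcover _ Kq0.
pose i0' : D := [` Di0]%fset.
case: (@arg_minP _ _ _ i0' xpredT (fun i : D => g (val i))) => //= i _ imin.
have /set_mem Ki := DK _ (valP i).
have [j Dj /=] := Dcover _ Ki.
by rewrite ltNge (imin [` Dj]%fset).
Qed.

End LowerSemicontinuity.

(** * The proximal mapping *)

Section ProximalStep.
Context {R : realType} {n : nat}.
Implicit Types (f : 'rV[R]_n -> \bar R) (x y p g : 'rV[R]_n) (a : R).

(** The existence of a minimizer [xs] of [f] replaces the coercivity that
convexity would give: a point [y] farther from [x] than [xs] has a larger
quadratic term and [f y >= f xs], so the search can be confined to a compact
set. That set is taken to be the cube around [x] circumscribed about the ball
through [xs], because it is a product of compact intervals. *)
Lemma prox_argmin f x a :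
  (forall y, (-oo < f y)%E) -> lower_semicontinuous f ->
  (exists y, (f y < +oo)%E) -> (exists xstar, argmin f xstar) -> 0 < a ->
  argmin (fun y => (a%:E * f y + (2^-1 * enorm (y - x) ^+ 2)%R%:E)%E)
    (prox a f x).
Proof.
move=> f_gtNy f_closed [y0 y0oo] [xs xsmin] a0; apply: getPex.
set phi := (X in argmin X).
have fs_fin : f xs \is a fin_num.
  by rewrite fin_numElt f_gtNy (le_lt_trans (xsmin y0)).
have phil : lower_semicontinuous phi.
  pose h y := 2^-1 * enorm (y - x) ^+ 2.
  apply: (lower_semicontinuous_scale_add (h := h)) => //.
  move=> y; apply: (@cvgM R _ (nbhs y)); first exact: cvg_cst.
  exact: continuous_sqr_enorm_sub.
pose d := enorm (xs - x).
pose A i := `[x 0 i - d, x 0 i + d]%classic.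
pose K := [set v : 'rV[R]_n | forall i, A i (v 0 i)].
have cK : compact K by apply: rV_compact => i; exact: segment_compact.
have inK y : enorm (y - x) ^+ 2 <= d ^+ 2 -> K y.
  rewrite sqr_enorm => yd i; rewrite /A /= in_itv /=.
  have := le_trans (sqr_coord_le_dot (y - x) i) yd.
  rewrite -ler_sqrt ?sqr_ge0// !sqrtr_sqr (ger0_norm (enorm_ge0 _)) !mxE.
  by rewrite ler_norml -/d => /andP[yl yr]; apply/andP; split; lra.
have [|p Kp pmin] := lower_semicontinuous_attains_min cK _ phil.
  by exists xs; exact: inK.
exists p => y; have [|yd] := leP (enorm (y - x) ^+ 2) (d ^+ 2).
  by move=> /inK; exact: pmin.
apply: (le_trans (pmin xs (inK xs _))) => //.
apply: leeD; first by rewrite lee_pmul2l// ?lte_fin.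
by rewrite lee_fin ler_pM2l ?invr_gt0// ltW.
Qed.

Lemma le0_of_le_mul (c d : R) :
  (forall t, 0 < t -> t <= 1 -> c <= t * d) -> c <= 0.
Proof.
move=> cd; rewrite leNgt; apply/negP => c0.
have cd1 := cd 1 ltr01 (lexx _); rewrite mul1r in cd1.
have d0 : 0 < d := lt_le_trans c0 cd1.
(* Were [c] positive, [t = c / (2 d)] would give [c <= c / 2]. *)
have dd0 : 0 < 2 * d by rewrite mulr_gt0.
have t0 : 0 < c / (2 * d) by rewrite divr_gt0.
have t1 : c / (2 * d) <= 1 by rewrite ler_pdivrMr//; lra.
have := cd _ t0 t1; have -> : c / (2 * d) * d = c / 2.
  by field; rewrite gt_eqF.
by lra.
Qed.

(** Comparing [p] with the points [p + t (y - p)] of the segment towards [y]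
gives, by convexity,
[a (f p - f y) + <x - p, y - p> <= t |y - p|^2 / 2] whenever [0 < t <= 1];
the claim is the limit [t -> 0]. *)
Lemma prox_subgradient f x p a :
  (forall y, (-oo < f y)%E) -> convex_efun f ->
  (exists y, (f y < +oo)%E) -> 0 < a ->
  argmin (fun y => (a%:E * f y + (2^-1 * enorm (y - x) ^+ 2)%R%:E)%E) p ->
  subdifferential f p (a^-1 *: (x - p)).
Proof.
move=> f_gtNy f_convex [y0 y0oo] a0 pmin.
have poo : (f p < +oo)%E.
  rewrite ltNge; apply/negP; rewrite leye_eq => /eqP fp.
  have := pmin y0; rewrite fp gt0_muley ?lte_fin//.
  have : f y0 \is a fin_num by rewrite fin_numElt f_gtNy.
  by case: (f y0).
split=> // y.
have [yoo|] := ltP (f y) +oo%E; last first.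
  by rewrite leye_eq => /eqP ->; rewrite leey.
have /fineK fpE : f p \is a fin_num by rewrite fin_numElt f_gtNy.
have /fineK fyE : f y \is a fin_num by rewrite fin_numElt f_gtNy.
rewrite -fpE -fyE -EFinD lee_fin.
set P := fine (f p) in fpE *; set Y := fine (f y) in fyE *.
suff : a * (P - Y) + dot (x - p) (y - p) <= 0.
  by move=> opt; rewrite dotZl -(ler_pM2l a0) mulrDr mulVKf ?gt_eqF//; lra.
apply: (@le0_of_le_mul _ (2^-1 * dot (y - p) (y - p))) => t t0 t1.
have := f_convex y p t (ltW t0) t1.
have := pmin (t *: y + (1 - t) *: p); move: (f_gtNy (t *: y + (1 - t) *: p)).
rewrite -fpE -fyE -!EFinM -!EFinD.
set z := t *: y + _; have -> : z - x = (p - x) + t *: (y - p).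
  by apply/rowP => i; rewrite !mxE; ring.
case: (f z) => [Z| |] //= _.
rewrite -EFinM -EFinD !lee_fin !sqr_enorm => pz zy.
rewrite -(ler_pM2l t0).
have aZ : a * Z <= a * (t * Y + (1 - t) * P) by rewrite ler_pM2l.
have -> : dot (x - p) (y - p) = - dot (p - x) (y - p).
  by rewrite -dotNl opprB.
move: pz; rewrite (dotDl (p - x)) !(dotDr _ (p - x)) !(dotZl, dotZr).
rewrite (dotC (y - p) (p - x)).
set s := dot (p - x) (y - p); set q := dot (y - p) (y - p).
set m := dot (p - x) (p - x).
by nra.
Qed.

End ProximalStep.

(** * Decrease of the potential *)

Section Potential.
Context {R : realType} {n : nat}.
Implicit Types (x g w : 'rV[R]_n) (a A F : R).

(** Expanding the square [|x - xs|^2 = |(xnext - xs) + a g|^2] leaves the cross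
term [a <g, xnext - xs>], which the subgradient inequality at [xs] bounds from
below by [a (Fnext - Fs)]. With [x] the starting point this bounds the
potential after the first step, whatever the value of [f] at [x] may be. *)
Lemma proximal_step_decrease a (x xnext g xs : 'rV[R]_n) Fnext Fs :
  0 < a -> xnext = x - a *: g ->
  Fnext + dot g (xs - xnext) <= Fs ->
  2^-1 * a ^+ 2 * dot g g + a * (Fnext - Fs) +
    2^-1 * dot (xnext - xs) (xnext - xs) <= 2^-1 * dot (x - xs) (x - xs).
Proof.
move=> a0 xE sub.
have -> : x - xs = (xnext - xs) + a *: g.
  by rewrite xE; apply/rowP => i; rewrite !mxE; ring.
move: sub; rewrite -opprB dotNr; set w := xnext - xs => sub.
have : a * (Fnext - Fs) <= a * dot g w by rewrite ler_pM2l//; lra.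
by clearbody w; rewrite !dotE (dotC w g); nra.
Qed.

(** Beyond [proximal_step_decrease], the potential grows by
[(2 A a + A^2) |gnext|^2 / 2 - A^2 |g|^2 / 2 + A (Fnext - F)]. Sufficient
decrease, [F - Fnext >= a |gnext|^2], absorbs [A a |gnext|^2], and the rest is
nonpositive because [|gnext| <= |g|], which is the monotonicity of the
subdifferential: [<g - gnext, x - xnext> >= 0] with [x - xnext = a gnext]. *)
Lemma potential_decrease a A (x xnext g gnext xs : 'rV[R]_n) F Fnext Fs :
  0 < a -> 0 <= A -> xnext = x - a *: gnext ->
  Fnext + dot gnext (xs - xnext) <= Fs ->
  Fnext + dot gnext (x - xnext) <= F ->
  F + dot g (xnext - x) <= Fnext ->
  2^-1 * (A + a) ^+ 2 * dot gnext gnext + (A + a) * (Fnext - Fs) +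
    2^-1 * dot (xnext - xs) (xnext - xs) <=
  2^-1 * A ^+ 2 * dot g g + A * (F - Fs) + 2^-1 * dot (x - xs) (x - xs).
Proof.
move=> a0 A0 xE subs sub subx.
have step := proximal_step_decrease a0 xE subs.
have dx : x - xnext = a *: gnext by rewrite xE opprB addrC subrK.
move: sub; rewrite dx dotZr => sub.
move: subx; rewrite -opprB dx dotNr dotZr => subx.
(* [<g, gnext> >= |gnext|^2] yields [|gnext| <= |g|] because
   [|g - gnext|^2 >= 0]. *)
have le_gg : dot gnext gnext <= dot g gnext by rewrite -(ler_pM2l a0); lra.
have gg : dot gnext gnext <= dot g g.
  by have := dot_ge0 (g - gnext); rewrite !dotE (dotC gnext g); lra.
have := ler_wpM2l A0 sub.
have := ler_wpM2l (sqr_ge0 A) gg.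
by nra.
Qed.

End Potential.

(** * The convergence rate *)

Unset Implicit Arguments.
Set Strict Implicit.

Theorem theorem4p1 (R : realType) (n : nat) (n_ge1 : (1 <= n)%N)
  (f : 'rV[R]_n -> \bar R)
  (f_gtNy : forall y, (-oo < f y)%E)
  (f_convex : convex_efun f)
  (f_closed : lower_semicontinuous f)
  (f_proper : exists y, (f y < +oo)%E)
  (alpha : nat -> R)
  (alpha_gt0 : forall i : nat, (1 <= i)%N -> 0 < alpha i)
  (r : R) (r_gt0 : 0 < r)
  (x : nat -> 'rV[R]_n)
  (x0_near : exists xstar : 'rV[R]_n, argmin f xstar /\ enorm (x 0%N - xstar) <= r)
  (x_prox : forall i : nat, (1 <= i)%N -> x i = prox (alpha i) f (x i.-1))
  (N : nat) (N_ge1 : (1 <= N)%N) :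
  (exists g : 'rV[R]_n, subdifferential f (x N) g /\
     enorm g <= r / \sum_(1 <= i < N.+1) alpha i) /\
  (let gN := (alpha N)^-1 *: (x N.-1 - x N) in
   subdifferential f (x N) gN /\
     enorm gN <= r / \sum_(1 <= i < N.+1) alpha i).
Proof.
have [xs [xsmin xsr]] := x0_near.
pose g i := (alpha i)^-1 *: (x i.-1 - x i).
have sub i : (1 <= i)%N -> subdifferential f (x i) (g i).
  move=> i1; apply: prox_subgradient => //; first exact: alpha_gt0.
  rewrite (x_prox i)//; apply: prox_argmin => //; last exact: alpha_gt0.
  by exists xs.
suff gN : enorm (g N) <= r / \sum_(1 <= i < N.+1) alpha i.
  have subN := sub _ N_ge1.
  by split; [exists (g N)|].
have xE i : x i.+1 = x i - alpha i.+1 *: g i.+1.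
  by rewrite /g scalerA divff ?gt_eqF ?alpha_gt0// scale1r opprB addrC subrK.
pose F i := fine (f (x i)); pose Fs := fine (f xs).
have FE i : (1 <= i)%N -> f (x i) = (F i)%:E.
  by move=> /sub[? _]; rewrite fineK// fin_numElt f_gtNy.
have FsE : f xs = Fs%:E.
  rewrite fineK// fin_numElt f_gtNy/=; have [y] := f_proper.
  exact: le_lt_trans.
have subs i : (1 <= i)%N -> F i + dot (g i) (xs - x i) <= Fs.
  by move=> i1; have [_ /(_ xs)] := sub _ i1; rewrite FE// FsE -EFinD lee_fin.
have subij i j : (1 <= i)%N -> (1 <= j)%N -> F i + dot (g i) (x j - x i) <= F j.
  by move=> i1 j1; have [_ /(_ (x j))] := sub _ i1; rewrite !FE// -EFinD lee_fin.
have sum_gt0 k : 0 < \sum_(1 <= i < k.+2) alpha i.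
  elim: k => [|k IH]; first by rewrite big_nat1 alpha_gt0.
  by rewrite big_nat_recr//= addr_gt0 ?alpha_gt0.
(* The induction starts at the first iterate, since [f (x 0)] may be [+oo]. *)
have potential k : let A := \sum_(1 <= i < k.+2) alpha i in
  2^-1 * A ^+ 2 * dot (g k.+1) (g k.+1) + A * (F k.+1 - Fs) +
    2^-1 * dot (x k.+1 - xs) (x k.+1 - xs) <=
  2^-1 * dot (x 0%N - xs) (x 0%N - xs).
  elim: k => [|k IH] /=.
    by rewrite big_nat1; apply: proximal_step_decrease;
      rewrite ?alpha_gt0// ?subs// xE.
  apply: le_trans IH; rewrite big_nat_recr//=.
  by apply: potential_decrease; rewrite ?alpha_gt0 ?subs ?subij// ltW.
case: N N_ge1 => // k _; pose A := \sum_(1 <= i < k.+2) alpha i.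
have A0 : 0 < A := sum_gt0 k.
have [Age0 rge0] := (ltW A0, ltW r_gt0).
have dotxs : dot (x 0%N - xs) (x 0%N - xs) <= r ^+ 2.
  by rewrite -sqr_enorm lerXn2r ?nnegrE ?enorm_ge0// ltW.
have Fmin : Fs <= F k.+1 by rewrite -lee_fin -FsE -FE//; exact: xsmin.
rewrite ler_pdivlMr// -(ler_pXn2r (n := 2)) ?nnegrE ?mulr_ge0 ?enorm_ge0//.
rewrite exprMn sqr_enorm -/A.
have := potential k; rewrite /= -/A.
have := dot_ge0 (x k.+1 - xs).
have : 0 <= A * (F k.+1 - Fs) by rewrite mulr_ge0 ?subr_ge0.
by lra.
Qed.
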